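(* For each boolean algebra $B$, the poset $\mathcal{TNO}(B)$ of tense necessity operators on $B$ is a bounded meet-semilattice, i.e., it has a least element, a greatest element, and all binary meets.
   Context: A necessity operator on a boolean algebra $B$ is a function $B\to B$ preserving finite meets (including the empty one); a possibility operator on $B$ is a function $B\to B$ preserving finite joins (including the empty one). Two possibility operators $\Diamond_F,\Diamond_P$ on $B$ are conjugate if for all $a,b\in B$: $\Diamond_F a\wedge b=0\iff\Diamond_P b\wedge a=0$. A possibility operator $\Diamond_F$ is a tense possibility operator if it has a conjugate; in this case $\Box_F=\neg\Diamond_F\neg$ is called a tense necessity operator. $\mathcal{TNO}(B)$ is the set of tense necessity operators on $B$, ordered pointwise: $f\le g$ iff $f(a)\le g(a)$ for all $a\in B$. *)

(* Defs.v *)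
From HB Require Import structures.
From mathcomp Require Import all_boot all_order.
From mathcomp Require Import boolp.

Set Implicit Arguments.
Unset Strict Implicit.
Unset Printing Implicit Defensive.

Import Order.Theory.
Local Open Scope order_scope.

(* In a [ctbDistrLatticeType] the case \bot = \top is allowed, so the
   one-element boolean algebra is included. *)

Section Operators.
Context {d : Order.disp_t} {B : ctbDistrLatticeType d}.
Implicit Types (f D DF DP : B -> B).

(* The families indexed by [s] include the empty one. *)
Definition necessity_operator f : Prop :=
  forall s : seq B, f (\meet_(x <- s) x) = \meet_(x <- s) f x.

Definition possibility_operator f : Prop :=
  forall s : seq B, f (\join_(x <- s) x) = \join_(x <- s) f x.

Definition conjugate DF DP : Prop :=
  forall a b : B, DF a `&` b = \bot <-> DP b `&` a = \bot.

Definition tense_possibility_operator DF : Prop :=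
  possibility_operator DF /\
  exists2 DP, possibility_operator DP & conjugate DF DP.

Definition box D : B -> B := fun a => ~` D (~` a).

Definition tense_necessity_operator f : Prop :=
  exists2 D, tense_possibility_operator D & f = box D.

Lemma box_necessity D : possibility_operator D -> necessity_operator (box D).
Proof.
move=> hD s; rewrite /box compl_meets -compl_joins.
by rewrite -(big_map Order.compl xpredT id) hD big_map.
Qed.

Lemma tense_necessity_is_necessity f :
  tense_necessity_operator f -> necessity_operator f.
Proof. by case=> D [hD _] ->; exact: box_necessity. Qed.

End Operators.

(* The membership proof is boolean so that [TNO B] is a [subType] of [B -> B]
   and inherits the library's pointwise order on functions (see [TNO_leP]). *)
Record TNO (d : Order.disp_t) (B : ctbDistrLatticeType d) := MkTNO {
  TNO_fun :> B -> B;
  TNO_subproof : `[< tense_necessity_operator TNO_fun >]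
}.

Section TNO_order.
Context {d : Order.disp_t} {B : ctbDistrLatticeType d}.

HB.instance Definition _ := [isSub for @TNO_fun d B].
HB.instance Definition _ := [Choice of TNO B by <:].
HB.instance Definition _ :=
  [SubChoice_isSubPOrder of TNO B by <: with FunOrder.fun_display].

Lemma TNOP (f : TNO B) : tense_necessity_operator f.
Proof. by case: f => f /= /asboolP. Qed.

Lemma TNO_leP (f g : TNO B) : reflect (forall a : B, f a <= g a) (f <= g).
Proof. exact: lefP. Qed.

End TNO_order.

(* Main.v *)
Require Import Defs.
From mathcomp Require Import all_boot all_order.
From mathcomp Require Import boolp classical_sets.
Local Open Scope classical_set_scope.
Local Open Scope order_scope.

(** [box] is antitone in the possibility operator, so binary meets come from
    pointwise joins of possibility operators, whose conjugates are the joins of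
    the conjugates. The greatest element comes from the constant operator
    [\bot] and the least one from the operator sending every nonzero element to
    [\top]; both are self-conjugate. *)

Import Order.Theory.

Section TenseOperators.
Context {d : Order.disp_t} {B : ctbDistrLatticeType d}.
Implicit Types (D E f g : B -> B) (a b : B).

Lemma possibility_operatorU D E :
  possibility_operator D -> possibility_operator E ->
  possibility_operator (fun a => D a `|` E a).
Proof. by move=> hD hE s; rewrite hD hE big_split. Qed.

Lemma tense_possibility_operatorU D E :
  tense_possibility_operator D -> tense_possibility_operator E ->
  tense_possibility_operator (fun a => D a `|` E a).
Proof.
move=> [hD [DP hDP cD]] [hE [EP hEP cE]]; split; first exact: possibility_operatorU.
exists (fun a => DP a `|` EP a); first exact: possibility_operatorU.
(* Meets distribute over joins, and a join is [\bot] exactly when both its terms are, so conjugacy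
   for the join splits into [cD] and [cE]. *)
move=> a b; rewrite !meetUl.
split=> /eqP; rewrite join_eq0 => /andP[/eqP hab /eqP hab'];
  apply/eqP; rewrite join_eq0; apply/andP; split; apply/eqP.
- exact/cD.
- exact/cE.
- exact/cD.
- exact/cE.
Qed.

Lemma tense_possibility_operator0 :
  tense_possibility_operator (fun _ : B => \bot : B).
Proof.
have h0 : possibility_operator (fun _ : B => \bot : B) by move=> s; rewrite big1.
by split=> //; exists (fun=> \bot) => // a b; rewrite !meet0x.
Qed.

(** The diamond of the universal modality. It is the largest map fixing [\bot], so its [box] is the
    smallest map fixing [\top]. *)
Definition nonzero_top a : B := if a == \bot then \bot else \top.

Lemma tense_possibility_operator_nonzero_top :
  tense_possibility_operator nonzero_top.
Proof.
have hT : possibility_operator nonzero_top.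
  move=> s; elim: s => [|a s IHs]; first by rewrite !big_nil /nonzero_top eqxx.
  rewrite !big_cons -IHs /nonzero_top join_eq0.
  by case: (a == \bot); case: (_ == \bot); rewrite ?join0x ?joinx0 ?join1x.
(* Self-conjugacy: both conditions say that [a] or [b] is [\bot]. *)
split=> //; exists nonzero_top => // a b; rewrite /nonzero_top.
by do 2 case: eqP => [->|?]; rewrite ?meet0x ?meetx0 ?meet1x.
Qed.

Lemma tense_necessity_operator_box D :
  tense_possibility_operator D -> tense_necessity_operator (box D).
Proof. by exists D. Qed.

Lemma tense_necessity_operatorI f g :
  tense_necessity_operator f -> tense_necessity_operator g ->
  tense_necessity_operator (fun a => f a `&` g a).
Proof.
move=> [D hD ->] [E hE ->]; exists (fun a => D a `|` E a).
  exact: tense_possibility_operatorU.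
(* De Morgan turns the join of the diamonds into the meet of the boxes. *)
by apply/funext => a; rewrite /box complU.
Qed.

Lemma necessity_operator1 f : necessity_operator f -> f \top = \top.
Proof. by move=> /(_ [::]); rewrite !big_nil. Qed.

Definition TNO_of {f} (hf : tense_necessity_operator f) : TNO B :=
  MkTNO (introT (asboolP _) hf).

End TenseOperators.

Theorem proposition4p4 (d : Order.disp_t) (B : ctbDistrLatticeType d) :
  [/\ exists b : TNO B, forall f : TNO B, b <= f,
      exists t : TNO B, forall f : TNO B, f <= t &
      forall f g : TNO B, exists m : TNO B, infimums [set f; g] m].
Proof.
split.
- exists (TNO_of (tense_necessity_operator_box _
    tense_possibility_operator_nonzero_top)) => f.
  apply/TNO_leP => a /=; rewrite /box /nonzero_top.
  (* The candidate takes the value [\bot] unless [a] is [\top], and there [f] also takes the value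
     [\top], as it preserves the empty meet. *)
  case: eqP => [/(congr1 Order.compl)|_]; last by rewrite compl1 le0x.
  rewrite complK compl0 => ->.
  by rewrite (necessity_operator1 _ (tense_necessity_is_necessity (TNOP f))).
- exists (TNO_of (tense_necessity_operator_box _ tense_possibility_operator0)) => f.
  by apply/TNO_leP => a /=; rewrite /box compl0 lex1.
(* The order is pointwise, so the pointwise meet is the infimum once it is known to be a tense
   necessity operator. *)
- move=> f g; exists (TNO_of (tense_necessity_operatorI _ _ (TNOP f) (TNOP g))).
  split.
    move=> h [->|->]; apply/TNO_leP => a; [exact: leIl|exact: leIr].
  move=> h lbh; apply/TNO_leP => a /=.
  by rewrite lexI; apply/andP; split; apply: (TNO_leP _ _ _); apply: lbh; [left|right].
Qed.
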